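(* Let $1\le p<\infty$ and let $X=c_0\oplus_p c_0$, that is, $c_0\times c_0$ with the norm $\|(x,y)\|=(\|x\|_\infty^p+\|y\|_\infty^p)^{1/p}$. Then every convex combination of slices of the closed unit ball $B_X$ has diameter at least $1$.
   Context: All Banach spaces are real. $B_X$ is the closed unit ball of $X$. A slice of $B_X$ is a set of the form $\{x\in B_X: x^*(x)>\sup x^*(B_X)-\alpha\}$ with $x^*\in X^*$ and $0<\alpha<\sup x^*(B_X)$. A convex combination of slices of $B_X$ is a set $\sum_{i=1}^n\lambda_i S_i=\{\sum_{i=1}^n\lambda_i x_i: x_i\in S_i\}$ where $n\in\mathbb{N}$, $S_1,\dots,S_n$ are slices of $B_X$, $\lambda_i>0$ and $\sum_{i=1}^n\lambda_i=1$. *)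

(* Defs.v *)
From HB Require Import structures.
From mathcomp Require Import all_boot all_order all_algebra.
From mathcomp Require Import all_classical all_reals all_analysis.
Set Implicit Arguments.
Unset Strict Implicit.
Unset Printing Implicit Defensive.
Import Order.TTheory GRing.Theory Num.Theory.
Import numFieldNormedType.Exports.
Local Open Scope classical_set_scope.
Local Open Scope ring_scope.

Definition null_seq (R : realType) : {pred nat -> R} :=
  fun u => `[< u @ \oo --> (0 : R) >].

Record c0 (R : realType) := C0 {
  c0_seq :> nat -> R;
  c0_null : c0_seq \in @null_seq R }.

HB.instance Definition _ (R : realType) := [isSub for @c0_seq R].
HB.instance Definition _ (R : realType) := [Choice of c0 R by <:].

Section c0_lmodule.
Variable R : realType.

Lemma null_seqP (u : nat -> R) :
  reflect (u @ \oo --> (0 : R)) (u \in @null_seq R).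
Proof. exact: asboolP. Qed.

Lemma null_seq_submod_closed : submod_closed (@null_seq R).
Proof.
split; first by apply/null_seqP; exact: cvg_cst.
move=> a u v /null_seqP u0 /null_seqP v0; apply/null_seqP.
rewrite -[X in _ --> X]addr0 -[X in _ --> X + _](mulr0 a).
by apply: cvgD => //; exact: cvgMl_tmp.
Qed.

HB.instance Definition _ :=
  GRing.isSubmodClosed.Build R (nat -> R) (@null_seq R) null_seq_submod_closed.
HB.instance Definition _ := [SubChoice_isSubLmodule of c0 R by <:].

End c0_lmodule.

Section c0_norm.
Variable R : realType.
Implicit Types u v : c0 R.

Definition c0_norm u : R := sup (range (fun n => `|u n|)).

Lemma c0_has_sup u : has_sup (range (fun n => `|u n|)).
Proof.
split; first by exists `|u 0%N|, 0%N.
have /null_seqP u0 := c0_null u.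
have : bounded_fun (c0_seq u) by apply: cvg_seq_bounded; apply/cvg_ex; exists 0.
have [+ _] := @ex_bound _ _ _ (c0_seq u) (globally setT)
  (globally_properfilter (I : [set: nat] 0%N)).
by move=> /[apply] -[M uM]; exists M => _ [n _ <-]; exact: uM.
Qed.

Lemma c0_norm_ge u n : `|u n| <= c0_norm u.
Proof. by apply: ub_le_sup; [exact: (c0_has_sup u).2|exists n]. Qed.

Lemma c0_norm_le u (M : R) : (forall n, `|u n| <= M) -> c0_norm u <= M.
Proof.
move=> uM; apply: ge_sup; first exact: (c0_has_sup u).1.
by move=> _ [n _ <-].
Qed.

Lemma c0_normD u v : c0_norm (u + v) <= c0_norm u + c0_norm v.
Proof.
apply: c0_norm_le => n.
by rewrite (le_trans (ler_normD _ _))// lerD// c0_norm_ge.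
Qed.

Lemma c0_normZ (a : R) u : c0_norm (a *: u) = `|a| * c0_norm u.
Proof.
have le (b : R) v : c0_norm (b *: v) <= `|b| * c0_norm v.
  by apply: c0_norm_le => n; rewrite normrM ler_wpM2l// c0_norm_ge.
apply/eqP; rewrite eq_le le/=.
have [->|a0] := eqVneq a 0.
  by rewrite normr0 mul0r (le_trans (normr_ge0 _) (c0_norm_ge _ 0%N)).
have := le a^-1 (a *: u).
by rewrite scalerA mulVf// scale1r normfV ler_pdivlMl// normr_gt0.
Qed.

Lemma c0_norm0_eq0 u : c0_norm u = 0 -> u = 0.
Proof.
move=> u0; apply/val_inj/funext => n /=.
by apply/eqP; rewrite -normr_le0 -u0 c0_norm_ge.
Qed.

HB.instance Definition _ :=
  Lmodule_isNormed.Build R (c0 R) c0_normD c0_normZ c0_norm0_eq0.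

Lemma c0_normE u : `|u| = sup (range (fun n => `|u n|)).
Proof. by []. Qed.

End c0_norm.

(* An alias of V * W, since the library already puts the max norm on V * W.
   The argument p1 is unused by the carrier; the norm needs it for the
   triangle inequality. *)
Definition lp_sum (R : realType) (p : R) (p1 : 1 <= p)
  (V W : normedModType R) : Type := (V * W)%type.

Section lp_sum.
Context (R : realType) (p : R) (p1 : 1 <= p) (V W : normedModType R).

HB.instance Definition _ := GRing.Lmodule.copy (lp_sum p1 V W) (V * W)%type.

Implicit Types z : lp_sum p1 V W.

Definition lp_norm z : R := (`|z.1| `^ p + `|z.2| `^ p) `^ p^-1.

Let p_gt0 : 0 < p. Proof. exact: lt_le_trans p1. Qed.
Let p_neq0 : p != 0. Proof. by rewrite gt_eqF. Qed.

Lemma lp_norm_ge0 z : 0 <= lp_norm z. Proof. exact: powR_ge0. Qed.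

Lemma lp_norm_powR z : lp_norm z `^ p = `|z.1| `^ p + `|z.2| `^ p.
Proof.
by rewrite /lp_norm -powRrM mulVf// powRr1// addr_ge0 ?powR_ge0.
Qed.

Lemma lp_norm_le z (M : R) : 0 <= M ->
  `|z.1| `^ p + `|z.2| `^ p <= M `^ p -> lp_norm z <= M.
Proof.
move=> M0; rewrite -lp_norm_powR => zM.
rewrite leNgt; apply/negP => /(gt0_ltr_powR p_gt0).
by rewrite !nnegrE M0 lp_norm_ge0 ltNge zM => /(_ isT isT).
Qed.

Lemma lp_norm0_eq0 z : lp_norm z = 0 -> z = 0.
Proof.
move=> z0; have := lp_norm_powR z; rewrite z0 powR0// => /esym/eqP.
rewrite paddr_eq0 ?powR_ge0// !powR_eq0 p_neq0 !andbT !normr_eq0.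
by case: z {z0} => x y /= /andP[/eqP-> /eqP->].
Qed.

Lemma lp_normZ (a : R) z : lp_norm (a *: z) = `|a| * lp_norm z.
Proof.
rewrite /lp_norm /= !normrZ !powRM// -mulrDr powRM ?addr_ge0 ?powR_ge0//.
by rewrite -powRrM mulfV// powRr1.
Qed.

Let powR_conv (l a b : R) : 0 <= l <= 1 -> 0 <= a -> 0 <= b ->
  (l * a + (1 - l) * b) `^ p <= l * a `^ p + (1 - l) * b `^ p.
Proof.
move=> /andP[l0 l1] a0 b0.
by apply: (convex_powR p1 (Itv01 l0 l1)); rewrite inE/= in_itv/= ?a0 ?b0.
Qed.

Let powR_addM (s t a b : R) : 0 < s -> 0 < t -> 0 <= a -> 0 <= b ->
  (s * a + t * b) `^ p <=
  (s + t) `^ p * (s / (s + t) * a `^ p + t / (s + t) * b `^ p).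
Proof.
move=> s0 t0 a0 b0; have st0 : 0 < s + t by exact: addr_gt0.
have st_neq0 : s + t != 0 by rewrite gt_eqF.
set l := s / (s + t).
have l01 : 0 <= l <= 1.
  apply/andP; split; first by apply: divr_ge0; exact: ltW.
  by rewrite ler_pdivrMr// mul1r lerDl ltW.
have -> : t / (s + t) = 1 - l.
  by rewrite -(mulfV st_neq0) -mulrBl addrAC subrr add0r.
have -> : s * a + t * b = (s + t) * (l * a + (1 - l) * b).
  have sl : (s + t) * l = s by rewrite mulrC divfK.
  have tl : (s + t) * (1 - l) = t by rewrite mulrBr mulr1 sl [LHS]addrC addKr.
  by rewrite mulrDr (mulrA _ l) (mulrA _ (1 - l)) sl tl.
have /andP[l0 l1] := l01.
rewrite powRM; [|exact: ltW|].
  by rewrite ler_wpM2l ?powR_ge0//; exact: powR_conv.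
by rewrite addr_ge0// mulr_ge0// subr_ge0.
Qed.

Let minkowski2 (a b c d s t : R) :
    0 <= a -> 0 <= b -> 0 <= c -> 0 <= d -> 0 < s -> 0 < t ->
  a `^ p + b `^ p = s `^ p -> c `^ p + d `^ p = t `^ p ->
  (a + c) `^ p + (b + d) `^ p <= (s + t) `^ p.
Proof.
move=> a0 b0 c0 d0 s0 t0 abs cdt.
have key x y : 0 <= x -> 0 <= y -> (x + y) `^ p <= (s + t) `^ p *
    (s / (s + t) * (x `^ p / s `^ p) + t / (s + t) * (y `^ p / t `^ p)).
  move=> x0 y0; have := @powR_addM s t (x / s) (y / t) s0 t0.
  rewrite !divr_ge0 ?(ltW s0) ?(ltW t0)// => /(_ isT isT).
  have mdivK (u v : R) : 0 < u -> u * (v / u) = v.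
    by move=> u0; rewrite mulrC divfK// gt_eqF.
  rewrite !mdivK//.
  have div_powR (r q : R) : 0 <= r -> 0 < q -> (r / q) `^ p = r `^ p / q `^ p.
    move=> r0 q0; rewrite powRM ?invr_ge0// ?(ltW q0)//; congr (_ * _).
    by rewrite -(powR_inv1 (ltW q0)) -powRrM mulN1r powRN.
  by rewrite !div_powR.
apply: le_trans (lerD (key _ _ a0 c0) (key _ _ b0 d0)) _.
rewrite -mulrDr addrACA -!mulrDr -!mulrDl abs cdt.
rewrite !mulfV ?gt_eqF ?powR_gt0//.
rewrite !mulr1 -mulrDl mulfV ?mulr1//.
by rewrite gt_eqF// addr_gt0.
Qed.

Lemma lp_normD z w : lp_norm (z + w) <= lp_norm z + lp_norm w.
Proof.
have [/lp_norm0_eq0 z0|z0] := eqVneq (lp_norm z) 0.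
  by rewrite {1}z0 add0r lerDr lp_norm_ge0.
have [/lp_norm0_eq0 w0|w0] := eqVneq (lp_norm w) 0.
  by rewrite {1}w0 addr0 lerDl lp_norm_ge0.
apply: lp_norm_le; first by apply: addr_ge0; exact: lp_norm_ge0.
apply: (@le_trans _ _ ((`|z.1| + `|w.1|) `^ p + (`|z.2| + `|w.2|) `^ p)).
  by apply: lerD; apply: ge0_ler_powR;
    rewrite ?nnegrE ?addr_ge0 ?normr_ge0 ?ler_normD// ltW.
have zp : 0 < lp_norm z by rewrite lt_def z0 lp_norm_ge0.
have wp : 0 < lp_norm w by rewrite lt_def w0 lp_norm_ge0.
exact: (minkowski2 (normr_ge0 z.1) (normr_ge0 z.2) (normr_ge0 w.1)
  (normr_ge0 w.2) zp wp (esym (lp_norm_powR z)) (esym (lp_norm_powR w))).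
Qed.

HB.instance Definition _ :=
  Lmodule_isNormed.Build R (lp_sum p1 V W) lp_normD lp_normZ lp_norm0_eq0.

Lemma lp_normE z : `|z| = (`|z.1| `^ p + `|z.2| `^ p) `^ p^-1.
Proof. by []. Qed.

End lp_sum.

Section slices.
Context (R : realType) (X : normedModType R).

Definition unit_ball : set X := [set x | `|x| <= 1].

(* For a continuous linear f, the set f @` unit_ball is nonempty and bounded, so
   the real supremum below is never the default value of sup. *)
Definition slice (f : {linear X -> R}) (alpha : R) : set X :=
  [set x | unit_ball x /\ f x > sup (f @` unit_ball) - alpha].

Definition is_slice (S : set X) : Prop :=
  exists (f : {linear X -> R}) (alpha : R),
    [/\ continuous f, 0 < alpha < sup (f @` unit_ball) & S = slice f alpha].

Definition is_convex_comb_slices (C : set X) : Prop :=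
  exists (n : nat) (lambda : 'I_n -> R) (S : 'I_n -> set X),
    [/\ forall i, is_slice (S i),
        forall i, 0 < lambda i,
        \sum_(i < n) lambda i = 1 &
        C = [set \sum_(i < n) lambda i *: x i |
              x in [set x : 'I_n -> X | forall i, S i (x i)]]].

Definition diameter (A : set X) : \bar R :=
  ereal_sup [set (`|x - y|)%:E | x in A & y in A].

End slices.

(* Main.v *)
Require Import Defs.
From mathcomp Require Import all_boot all_order all_algebra.
From mathcomp Require Import all_classical all_reals all_analysis.
Import Order.TTheory GRing.Theory Num.Theory.
Import numFieldNormedType.Exports.
Local Open Scope classical_set_scope.
Local Open Scope ring_scope.
Set Implicit Arguments.
Unset Strict Implicit.
Unset Printing Implicit Defensive.

(** The idea is to move a point far out in [c0] without changing its norm and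
    almost without changing the values of finitely many functionals.

    The canonical vectors [e_n] of either summand have signed sums bounded in
    norm by [1], so every continuous linear [f] is absolutely summable along
    them; in particular [f e_n] tends to [0] ([signed_sums_cvg0]). Each slice
    [S_i] contains a point [(x_i, y_i)] of norm exactly [1]
    ([slice_unit_vector]). Overwriting the [n]-th entries of [x_i] and [y_i] by
    [s |x_i|] and [s |y_i|] ([spike]), for a sign [s], keeps both norms at most
    what they were and moves the value of the functional defining [S_i] by an
    amount that vanishes as [n] grows ([spike_slice]). So one [n] puts the
    spiked points for [s = 1] and [s = -1] in all the slices at once.

    The corresponding two points of the convex combination differ, at the entry
    [n] of the two summands, by [2 A] and [2 B], where [A] and [B] are the
    [lambda]-averages of the [|x_i|] and of the [|y_i|]. Since
    [|x_i| + |y_i| >= |(x_i, y_i)| = 1], we have [A + B >= 1], and the distance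
    of the two points is at least [max (2 A) (2 B) >= A + B >= 1]. *)

(** * Functionals along sequences with bounded signed sums *)

(** Choosing for [c k] the sign of [f (e k)] turns the bound on signed sums into
    a bound on the partial sums of [|f (e k)|], so this series converges. *)
Lemma signed_sums_cvg0 (R : realType) (X : normedModType R)
    (f : {linear X -> R}) (e : nat -> X) (M : R) :
  continuous f ->
  (forall (c : nat -> R) (N : nat), (forall k, `|c k| <= 1) ->
     `|\sum_(0 <= k < N) c k *: e k| <= M) ->
  f (e n) @[n --> \oo] --> (0 : R).
Proof.
move=> /linear_bounded_continuous/linear_boundedP[K [_ fK]] eM.
have {}fK x : `|f x| <= `|K + 1| * `|x|.
  rewrite (le_trans (fK (K + 1) _ x)) ?ltrDl//.
  by rewrite ler_wpM2r// ler_norm.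
apply: norm_cvg0; apply: cvg_series_cvg_0.
apply: nondecreasing_is_cvgn.
  by apply: nondecreasing_series => k _ _; exact: normr_ge0.
exists (`|K + 1| * M) => _ [N _ <-].
pose c k := Num.sg (f (e k)).
have c1 k : `|c k| <= 1 by rewrite normr_sg lern1 leq_b1.
rewrite /series/= (_ : \sum_(0 <= k < N) `|f (e k)| =
    f (\sum_(0 <= k < N) c k *: e k)); last first.
  rewrite linear_sum/=; apply: eq_bigr => k _.
  by rewrite linearZ/= normrEsg.
rewrite (le_trans (ler_norm _))// (le_trans (fK _))//.
by rewrite ler_wpM2l// eM.
Qed.

(** * Unit vectors and spikes in c0 *)

Lemma c0_unit_null (R : realType) (n : nat) :
  (fun k => (k == n)%:R : R) \in @null_seq R.
Proof.
apply/null_seqP; apply: cvg_near_cst.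
by exists n.+1 => // k /= nk; rewrite gtn_eqF.
Qed.

Definition c0_unit (R : realType) (n : nat) : c0 R := C0 (c0_unit_null R n).

Lemma c0_sumE (R : realType) (I : Type) (r : seq I) (P : pred I)
    (F : I -> c0 R) (n : nat) :
  (\sum_(i <- r | P i) F i) n = \sum_(i <- r | P i) F i n.
Proof. exact: (big_morph (fun u : c0 R => u n)). Qed.

Lemma c0_scale_unitE (R : realType) (a : R) (n k : nat) :
  (a *: c0_unit R n) k = a * (k == n)%:R.
Proof. by []. Qed.

Lemma c0_unit_sum_norm (R : realType) (c : nat -> R) (N : nat) :
  (forall k, `|c k| <= 1) ->
  `|\sum_(0 <= k < N) c k *: c0_unit R k| <= 1.
Proof.
move=> c1; apply: c0_norm_le => m; rewrite c0_sumE big_mkord.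
have [mN|Nm] := ltnP m N.
  rewrite (bigD1 (Ordinal mN))// big1 => [|i im].
    by rewrite c0_scale_unitE eqxx mulr1 /= addr0.
  rewrite c0_scale_unitE (_ : (m == i) = false) ?mulr0//.
  by rewrite eq_sym; exact: negbTE im.
rewrite big1 ?normr0// => i _.
by rewrite c0_scale_unitE gtn_eqF ?mulr0// (leq_trans _ Nm).
Qed.

(** The sequence [u] with its entry of index [n] overwritten by [t], written as
    a perturbation of [u] so that linear functionals apply to it. *)
Definition spike (R : realType) (n : nat) (t : R) (u : c0 R) : c0 R :=
  u + (t - u n) *: c0_unit R n.

Lemma spikeE (R : realType) (n : nat) (t : R) (u : c0 R) (k : nat) :
  spike n t u k = if k == n then t else u k.
Proof.
rewrite (_ : spike n t u k = u k + ((t - u n) *: c0_unit R n) k)//.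
rewrite c0_scale_unitE; have [->|_] := eqVneq k n; rewrite ?mulr1 ?mulr0 ?addr0//.
by rewrite addrC subrK.
Qed.

Lemma spike_norm_le (R : realType) (n : nat) (t : R) (u : c0 R) :
  `|t| <= `|u| -> `|spike n t u| <= `|u|.
Proof.
move=> tu; apply: c0_norm_le => k; rewrite spikeE.
by case: ifP => // _; exact: c0_norm_ge.
Qed.

(** At the entry of index [n] the two spikes of [u i] differ by exactly
    [2 * `|u i|], whatever [u i] was there; the norm dominates that entry. *)
Lemma spike_sumB_norm (R : realType) (m n : nat) (lambda : 'I_m -> R)
    (u : 'I_m -> c0 R) :
  2 * \sum_i lambda i * `|u i| <=
  `|\sum_i lambda i *: spike n (1 * `|u i|) (u i)
    - \sum_i lambda i *: spike n (-1 * `|u i|) (u i)|.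
Proof.
set v := _ - _.
have -> : 2 * \sum_i lambda i * `|u i| = v n; last first.
  exact: le_trans (ler_norm _) (c0_norm_ge _ _).
rewrite /v -sumrB c0_sumE mulr_sumr; apply: eq_bigr => i _.
rewrite -scalerBr (_ : (_ *: _ : c0 R) n = lambda i *
  (spike n (1 * `|u i|) (u i) n - spike n (-1 * `|u i|) (u i) n))//.
by rewrite !spikeE eqxx mul1r mulN1r opprK mulrCA mulr2n mulrDl mul1r.
Qed.

(** * Norms in the lp-sum *)

Section lp_sum_norms.
Context (R : realType) (p : R) (p1 : 1 <= p) (V W : normedModType R).
Implicit Types z : lp_sum p1 V W.

Let p_gt0 : 0 < p. Proof. exact: lt_le_trans p1. Qed.

Lemma lp_norm_mono z (z' : lp_sum p1 V W) :
  `|z.1| <= `|z'.1| -> `|z.2| <= `|z'.2| -> `|z| <= `|z'|.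
Proof.
move=> z1 z2; apply: lp_norm_le => //.
by rewrite lp_norm_powR lerD// ge0_ler_powR ?nnegrE// ltW.
Qed.

Lemma lp_norm_inl (x : V) : `|((x, 0) : lp_sum p1 V W)| <= `|x|.
Proof. by apply: lp_norm_le => //=; rewrite normr0 powR0 ?addr0// gt_eqF. Qed.

Lemma lp_norm_inr (y : W) : `|((0, y) : lp_sum p1 V W)| <= `|y|.
Proof. by apply: lp_norm_le => //=; rewrite normr0 powR0 ?add0r// gt_eqF. Qed.

(** The triangle inequality for [z = (z.1, 0) + (0, z.2)]. *)
Lemma lp_norm_leD z : `|z| <= `|z.1| + `|z.2|.
Proof.
have -> : z = ((z.1, 0) : lp_sum p1 V W) + ((0, z.2) : lp_sum p1 V W).
  by case: z => x y; congr pair; rewrite /= ?addr0 ?add0r.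
rewrite (le_trans (ler_normD _ _))//= addr0 add0r.
by rewrite lerD ?lp_norm_inl ?lp_norm_inr.
Qed.

Let le_of_powR (a b : R) : 0 <= a -> 0 <= b -> a `^ p <= b `^ p -> a <= b.
Proof.
move=> a0 b0 ab; rewrite leNgt; apply/negP => /(gt0_ltr_powR p_gt0).
by rewrite !nnegrE a0 b0 ltNge ab => /(_ isT isT).
Qed.

Lemma lp_norm_ge1 z : `|z.1| <= `|z|.
Proof. by apply: le_of_powR; rewrite // lp_norm_powR lerDl powR_ge0. Qed.

Lemma lp_norm_ge2 z : `|z.2| <= `|z|.
Proof. by apply: le_of_powR; rewrite // lp_norm_powR lerDr powR_ge0. Qed.

End lp_sum_norms.

(** * Points of slices *)

(** The functional takes a positive value on a slice, so normalizing a point of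
    the slice does not decrease it. *)
Lemma slice_unit_vector (R : realType) (X : normedModType R)
    (f : {linear X -> R}) (alpha : R) :
  0 < alpha < sup (f @` @unit_ball R X) ->
  exists2 z, slice f alpha z & `|z| = 1.
Proof.
move=> /andP[alpha0 alpha_sup].
have [||_ [z zB <-] fz] := @sup_gt R (f @` @unit_ball R X)
    (sup (f @` @unit_ball R X) - alpha).
- by exists (f 0), 0 => //; rewrite /unit_ball/= normr0.
- by rewrite ltrBlDr ltrDl.
have fz0 : 0 < f z by rewrite (lt_trans _ fz)// subr_gt0.
have z0 : 0 < `|z|.
  rewrite normr_gt0; apply: contraTneq fz0 => ->.
  by rewrite linear0 ltxx.
have z1 : `|(`|z|^-1 *: z)| = 1.
  by rewrite normrZ normfV normr_id mulVf// gt_eqF.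
exists (`|z|^-1 *: z) => //; split; first by rewrite /unit_ball/= z1.
rewrite linearZ/= (lt_le_trans fz)//.
by rewrite ler_peMl ?(ltW fz0)// invf_ge1.
Qed.

Section spike_pair.
Context (R : realType) (p : R) (p1 : 1 <= p).
Local Notation X := (lp_sum p1 (c0 R) (c0 R)).

Definition spike_pair (n : nat) (s : R) (z : X) : X :=
  (spike n (s * `|z.1|) z.1, spike n (s * `|z.2|) z.2).

Lemma spike_pair_norm (n : nat) (s : R) (z : X) :
  `|s| <= 1 -> `|spike_pair n s z| <= `|z|.
Proof.
move=> s1; apply: lp_norm_mono => /=; apply: spike_norm_le;
  by rewrite normrM normr_id ler_piMl.
Qed.

Lemma c0_unit_inl_cvg0 (f : {linear X -> R}) : continuous f ->
  f ((c0_unit R n, 0) : X) @[n --> \oo] --> (0 : R).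
Proof.
move=> fc; apply: (signed_sums_cvg0 (M := 1) fc) => c N c1.
rewrite (_ : \sum_(_ <= _ < _) _ =
    ((\sum_(0 <= k < N) c k *: c0_unit R k, 0) : X)).
  by rewrite (le_trans (lp_norm_inl _ _ _))// c0_unit_sum_norm.
elim: N => [|N IH]; first by rewrite !big_geq.
by rewrite !big_nat_recr//= IH; congr pair; rewrite /= scaler0 addr0.
Qed.

Lemma c0_unit_inr_cvg0 (f : {linear X -> R}) : continuous f ->
  f ((0, c0_unit R n) : X) @[n --> \oo] --> (0 : R).
Proof.
move=> fc; apply: (signed_sums_cvg0 (M := 1) fc) => c N c1.
rewrite (_ : \sum_(_ <= _ < _) _ =
    ((0, \sum_(0 <= k < N) c k *: c0_unit R k) : X)).
  by rewrite (le_trans (lp_norm_inr _ _ _))// c0_unit_sum_norm.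
elim: N => [|N IH]; first by rewrite !big_geq.
by rewrite !big_nat_recr//= IH; congr pair; rewrite /= scaler0 addr0.
Qed.

(** The two perturbations have coefficients that converge, since null sequences
    do, and directions along which [f] tends to [0]. *)
Lemma spike_pair_cvg (f : {linear X -> R}) (s : R) (z : X) : continuous f ->
  f (spike_pair n s z) @[n --> \oo] --> f z.
Proof.
move=> fc.
have -> : (fun n => f (spike_pair n s z)) = fun n =>
    f z + (s * `|z.1| - z.1 n) * f ((c0_unit R n, 0) : X)
        + (s * `|z.2| - z.2 n) * f ((0, c0_unit R n) : X).
  apply/funext => n; rewrite -!linearZ -!linearD; congr (f _).
  by case: z => x y; congr pair; rewrite /= scaler0 addr0.
have cvg_entry0 (u : c0 R) (t : R) (g : nat -> R) :
    g n @[n --> \oo] --> (0 : R) -> (t - u n) * g n @[n --> \oo] --> (0 : R).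
  move=> g0; rewrite -[X in _ --> X](mulr0 (t - 0)); apply: cvgM => //.
  by apply: cvgB; [exact: cvg_cst|apply/null_seqP; exact: c0_null].
rewrite -[X in _ --> X]addr0 -[X in _ --> X + _]addr0; apply: cvgD; first apply: cvgD.
- exact: cvg_cst.
- by apply: cvg_entry0; exact: c0_unit_inl_cvg0.
- by apply: cvg_entry0; exact: c0_unit_inr_cvg0.
Qed.

Lemma spike_slice (f : {linear X -> R}) (alpha s : R) (z : X) :
  continuous f -> `|s| <= 1 -> slice f alpha z ->
  \forall n \near \oo, slice f alpha (spike_pair n s z).
Proof.
move=> fc s1 [zB fz].
near=> n; split.
  by rewrite /unit_ball/= (le_trans (spike_pair_norm _ _ s1)).
by near: n; exact: cvgr_gt _ (spike_pair_cvg s (z := z) fc) _ fz.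
Unshelve. all: by end_near. Qed.

(** The norm of the difference dominates those of both components, hence their
    average; this average is where the factor [2] is spent. *)
Lemma spike_comb_dist (m n : nat) (lambda : 'I_m -> R) (z : 'I_m -> X) :
  \sum_i lambda i * (`|(z i).1| + `|(z i).2|) <=
  `|\sum_i lambda i *: spike_pair n 1 (z i)
    - \sum_i lambda i *: spike_pair n (-1) (z i)|.
Proof.
set d := _ - _.
have le1 : 2 * \sum_i lambda i * `|(z i).1| <= `|d|.
  rewrite (le_trans (spike_sumB_norm n lambda (fun i => (z i).1)))//.
  rewrite (le_trans _ (lp_norm_ge1 d))//.
  by rewrite /d /= !(big_morph (fun w : X => w.1) (id1 := 0) (op1 := +%R)).
have le2 : 2 * \sum_i lambda i * `|(z i).2| <= `|d|.
  rewrite (le_trans (spike_sumB_norm n lambda (fun i => (z i).2)))//.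
  rewrite (le_trans _ (lp_norm_ge2 d))//.
  by rewrite /d /= !(big_morph (fun w : X => w.2) (id1 := 0) (op1 := +%R)).
rewrite -(ler_pM2l (ltr0Sn R 1)).
under eq_bigr do rewrite mulrDr.
by rewrite big_split/= mulrDr (le_trans (lerD le1 le2))// mulr2n mulrDl mul1r.
Qed.

End spike_pair.

Theorem proposition2p1 (R : realType) (p : R) (p1 : 1 <= p)
    (C : set (lp_sum p1 (c0 R) (c0 R))) :
  is_convex_comb_slices C -> (1%:E <= diameter C)%E.
Proof.
move=> [m [lambda [S [sliceS lambda0 lambda1 ->]]]].
have /choice[z zP] i : exists z : lp_sum p1 (c0 R) (c0 R), `|z| = 1 /\
    forall s : R, `|s| <= 1 -> \forall n \near \oo, S i (spike_pair n s z).
  have [f [alpha [fc alphaf ->]]] := sliceS i.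
  have [z zS z1] := slice_unit_vector alphaf.
  by exists z; split => // s s1; exact: spike_slice.
have all_near (s : R) : `|s| <= 1 ->
    \forall n \near \oo, forall i, S i (spike_pair n s (z i)).
  by move=> s1; apply: filter_forall => i; exact: (zP i).2.
have [n [Sp Sm]] : exists n, (forall i, S i (spike_pair n 1 (z i))) /\
    (forall i, S i (spike_pair n (-1) (z i))).
  near \oo => n; exists n; split; near: n; apply: all_near;
    by rewrite ?normrN normr1.
apply: le_ereal_sup_tmp.
eexists.
  exists (\sum_i lambda i *: spike_pair n 1 (z i)).
    by exists (fun i => spike_pair n 1 (z i)).
  exists (\sum_i lambda i *: spike_pair n (-1) (z i)) => //.
  by exists (fun i => spike_pair n (-1) (z i)).
rewrite lee_fin (le_trans _ (spike_comb_dist n lambda z))// -lambda1.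
apply: ler_sum => i _; rewrite ler_peMr ?(ltW (lambda0 i))//.
by rewrite -(zP i).1 lp_norm_leD.
Unshelve. all: by end_near. Qed.
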